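(* Let $q\in L_1^{\rm loc}(\mathbb R)$, $q\ge0$, with $\int_{-\infty}^{\infty}q(t)\,dt=\infty$. Then $d_0<\infty$ if and only if $q_0(a)>0$ for some $a\in(0,\infty)$.
   Context: For $x\in\mathbb R$, $d(x)=\inf\{d\ge0:\int_{x-d}^{x+d}q(\xi)\,d\xi=2\}$, and $d_0=\sup_{x\in\mathbb R}d(x)$. For $a\in(0,\infty)$, $q_0(a)=\inf_{x\in\mathbb R}\int_{x-a}^{x+a}q(t)\,dt$. *)

(* Defs.v *)
From HB Require Import structures.
From mathcomp Require Import all_boot all_order all_algebra.
From mathcomp Require Import all_classical all_reals all_analysis.
Import Order.TTheory GRing.Theory Num.Theory.

Set Implicit Arguments.
Unset Strict Implicit.
Unset Printing Implicit Defensive.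

Local Open Scope classical_set_scope.
Local Open Scope ring_scope.
Local Open Scope ereal_scope.

Definition centered_integral (R : realType) (q : R -> R) (x r : R) : \bar R :=
  \int[lebesgue_measure]_(t in `[(x - r)%R, (x + r)%R]) (q t)%:E.

(* All infima and suprema are taken in \bar R (so the infimum of the empty set
   is +oo and an unbounded supremum is +oo), not with the real-valued [inf] and
   [sup], which return 0 in those cases. *)
Definition dist_q (R : realType) (q : R -> R) (x : R) : \bar R :=
  ereal_inf [set r%:E | r in
    [set r : R | (0 <= r)%R /\ centered_integral q x r = (2%R)%:E]].

Definition d0 (R : realType) (q : R -> R) : \bar R :=
  ereal_sup [set dist_q q x | x in [set: R]].

Definition q0 (R : realType) (q : R -> R) (a : R) : \bar R :=
  ereal_inf [set centered_integral q x a | x in [set: R]].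

(* Main.v *)
(** If [d0] is finite, every centered interval of radius [d0 + 1] contains
    one of [q]-mass 2, so [q0 (d0 + 1) >= 2].  Conversely, if [q0 a >= c > 0], an
    interval of radius [n * a] is a union of [n] intervals of radius [a], so
    its mass is at least [n * c >= 2] for [n] large; by continuity of the mass
    in the radius, mass 2 is attained at some radius at most [n * a],
    uniformly in the center. *)
Require Import Defs.
From HB Require Import structures.
From mathcomp Require Import all_boot all_order all_algebra.
From mathcomp Require Import all_classical all_reals all_analysis.
From mathcomp Require Import measurable_realfun lra.
Import Order.TTheory GRing.Theory Num.Theory.
Import numFieldNormedType.Exports.

Local Open Scope classical_set_scope.
Local Open Scope ring_scope.
Local Open Scope ereal_scope.

Section segment_integrals.
Context {R : realType} {q : R -> R}.
Hypothesis q_loc : locally_integrable [set: R] q.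
Hypothesis q_ge0 : {ae @lebesgue_measure R, forall t, (0 <= q t)%R}.
Notation mu := (@lebesgue_measure R).
Local Open Scope ring_scope.

Let I (u v : R) : R := \int[mu]_(t in `[u, v]) q t.

Lemma integrable_segment (u v : R) : mu.-integrable `[u, v] (EFin \o q).
Proof.
have [mq _ qK] := q_loc; apply/integrableP; split.
  by apply/measurable_EFinP; exact: measurable_funS mq.
exact: (qK _ (@subsetT _ _) (@segment_compact _ u v)).
Qed.

Lemma centered_integralE (x r : R) :
  centered_integral q x r = (I (x - r) (x + r))%:E.
Proof.
rewrite /I fineK//; apply: integrable_fin_num => //.
exact: integrable_segment.
Qed.

(** Since [q] is nonnegative only almost everywhere, it is first replaced under the integral by its
    absolute value, which agrees with it off a null set. *)
Lemma segment_integral_ge0 (u v : R) : 0 <= I u v.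
Proof.
rewrite /I /Rintegral (@ae_eq_integral _ _ _ mu _ (fun t => `|q t|%:E))//.
- by apply/fine_ge0/integral_ge0 => t _; rewrite lee_fin.
- exact: measurable_int (integrable_segment u v).
- have [mq _ _] := q_loc.
  apply/measurable_EFinP; apply: measurableT_comp => //.
  exact: measurable_funS mq.
- case: q_ge0 => N [mN N0 qN]; exists N; split => // t qt.
  by apply: qN => /= qt0; apply: qt => _; rewrite ger0_norm.
Qed.

Lemma segment_integral_cat (u v w : R) : u <= v -> v <= w ->
  I u w = I u v + I v w.
Proof.
move=> uv vw; rewrite /I.
have iq := integrable_segment u w.
have := @Rintegral_itvB R q (BLeft u) (BRight w) v iq.
rewrite !bnd_simp => /(_ uv vw).
rewrite Rintegral_itv_obnd_cbnd => [<-|]; first by rewrite addrC subrK.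
apply: integrableS (integrable_segment v w) => //.
exact: subset_itv_oc_cc.
Qed.

Lemma segment_integral_mono (u' u v v' : R) : u' <= u -> u <= v -> v <= v' ->
  I u v <= I u' v'.
Proof.
move=> u'u uv vv'.
rewrite (@segment_integral_cat u' u v')//; last exact: le_trans vv'.
rewrite (@segment_integral_cat u v v')//.
have := segment_integral_ge0 u' u; have := segment_integral_ge0 v v'; lra.
Qed.

(** Induction on [n], splitting off the leftmost block of length [2a], whose center is [u + a]. *)
Lemma segment_integral_ge_mulrn (a c : R) : 0 < a ->
  (forall x, c <= I (x - a) (x + a)) ->
  forall (n : nat) u, c *+ n <= I u (u + (a *+ 2) *+ n).
Proof.
move=> a0 ca; elim=> [|n IH] u; first by rewrite mulr0n segment_integral_ge0.
rewrite (@segment_integral_cat u (u + a *+ 2)); last 2 first.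
- by rewrite lerDl mulrn_wge0// ltW.
- by rewrite lerD2l [leRHS]mulrS lerDl !mulrn_wge0// ltW.
have := ca (u + a); have := IH (u + a *+ 2).
rewrite addrK -(addrA u a) -mulr2n -addrA -(mulrS (a *+ 2)) (mulrS c); lra.
Qed.

(** With a fixed base point [A] to the left of every segment involved, the integral is a difference
    of two values of the primitive [I A], which is continuous. *)
Lemma continuous_centered_integral (x b : R) : 0 <= b ->
  {within `[0, b], continuous (fun r => I (x - r) (x + r))}.
Proof.
(* The margin 1 keeps [x - r] and [x + r] strictly between [A] and [B], where the primitive is
   continuous in the ordinary, two-sided sense. *)
move=> b0; pose A := x - b - 1; pose B := x + b + 1.
have AB : A <= B by rewrite /A /B; lra.
have cG t : A < t < B -> {for t, continuous (I A)}.
  move=> tAB.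
  have /continuous_within_itvP :=
    parameterized_integral_continuous AB (integrable_segment A B).
  case; first by case/andP: tAB; exact: lt_trans.
  by move=> + _ _; apply; rewrite in_itv.
have cF : {in `[0, b], continuous (fun r => I A (x + r) - I A (x - r))}.
  move=> r /andP[]; rewrite !bnd_simp => r0 rb.
  apply: cvgB.
  - apply: (@continuous_comp _ _ _ (fun r => x + r) (I A)).
      by apply: continuousD; [exact: cst_continuous|exact: cvg_id].
    by apply: cG; rewrite /A /B; lra.
  - apply: (@continuous_comp _ _ _ (fun r => x - r) (I A)).
      by apply: continuousB; [exact: cst_continuous|exact: cvg_id].
    by apply: cG; rewrite /A /B; lra.
apply: (@subspace_eq_continuous _ _ _ (fun r => I A (x + r) - I A (x - r))).
  move=> r; rewrite inE/= in_itv/= => /andP[r0 rb].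
  have Axr : A <= x - r by rewrite /A; lra.
  have rxr : x - r <= x + r by lra.
  by rewrite (segment_integral_cat _ _ _ Axr rxr) addrC addKr.
apply: continuous_in_subspaceT => r.
by rewrite inE/= => rb; exact: cF.
Qed.

(** Intermediate value theorem in the radius: the integral vanishes at radius 0, where the segment
    is a point, and is at least [c] at radius [b]. *)
Lemma centered_integral_attains (x b c : R) : 0 <= b ->
  0 <= c <= I (x - b) (x + b) ->
  exists2 r, 0 <= r <= b & centered_integral q x r = c%:E.
Proof.
move=> b0 /andP[c0 cb].
have I0 : I (x - 0) (x + 0) = 0.
  by rewrite subr0 addr0 /I set_itv1 Rintegral_set1.
have [|r] := IVT b0 (continuous_centered_integral x b b0) (v := c).
  by rewrite I0 ge_min le_max c0 cb orbT.
by rewrite in_itv/= => rb Ir; exists r => //; rewrite centered_integralE Ir.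
Qed.

End segment_integrals.

Theorem corollary1p4 (R : realType) (q : R -> R)
    (q_loc : locally_integrable [set: R] q)
    (q_ge0 : {ae @lebesgue_measure R, forall t, (0 <= q t)%R})
    (q_int : \int[@lebesgue_measure R]_t (q t)%:E = +oo) :
  d0 q < +oo <-> exists a : R, (0 < a)%R /\ 0 < q0 q a.
Proof.
split=> [d0_fin|[a [a0 q0a]]].
- have dist_ge0 x : 0 <= dist_q q x.
    by apply: le_ereal_inf_tmp => _ [r [r0 _] <-]; rewrite lee_fin.
  have dist_le x : dist_q q x <= d0 q.
    by apply: ereal_sup_ubound; exists x.
  (* This excludes the value [-oo], so [d0 q] is a real number. *)
  have d0_ge0 : 0 <= d0 q := le_trans (dist_ge0 0%R) (dist_le 0%R).
  have d0E : d0 q = (fine (d0 q))%:E by rewrite fineK// ge0_fin_numE.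
  have fd0 : (0 <= fine (d0 q))%R by exact: fine_ge0.
  (* The added 1 makes the bound on [dist_q q x] strict, so the infimum yields an actual radius of
     mass 2 below it, attained or not. *)
  exists (fine (d0 q) + 1)%R; split; first by lra.
  apply: (@lt_le_trans _ _ (2%R)%:E); first by rewrite lte_fin.
  apply: le_ereal_inf_tmp => _ [x _ <-].
  have : dist_q q x < (fine (d0 q) + 1)%:E.
    by rewrite (le_lt_trans (dist_le x))// d0E lte_fin; lra.
  move=> /ereal_inf_lt[_ [r [r0 xr2] <-]].
  rewrite lte_fin => rlt; rewrite -xr2 !centered_integralE// lee_fin.
  by apply: segment_integral_mono => //; lra.
- have [c c0 cle] : exists2 c : R, (0 < c)%R &
      forall x, c%:E <= centered_integral q x a.
    have q0_le x : q0 q a <= centered_integral q x a.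
      by apply: ereal_inf_lbound; exists x.
    exists (fine (q0 q a)).
      rewrite fine_gt0// q0a (le_lt_trans (q0_le 0%R))//.
      by rewrite centered_integralE// ltry.
    move=> x; rewrite fineK// ge0_fin_numE ?(ltW q0a)//.
    by rewrite (le_lt_trans (q0_le 0%R))// centered_integralE// ltry.
  have [n nc] : exists n : nat, (2 <= c *+ n)%R.
    exists (Num.bound (2 / c)); rewrite -[leRHS]mulr_natl -ler_pdivrMr// ltW//.
    by apply: archi_boundP; rewrite divr_ge0// ltW.
  apply: (@le_lt_trans _ _ (a *+ n)%:E); last exact: ltry.
  apply: ge_ereal_sup => _ [x _ <-].
  have b0 : (0 <= a *+ n)%R by rewrite mulrn_wge0// ltW.
  have [|r /andP[r0 rb] xr2] := @centered_integral_attains _ _ q_loc x _ 2 b0.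
    rewrite ler0n/= (le_trans nc)//.
    have ca y : (c <= \int[lebesgue_measure]_(t in `[y - a, y + a]) q t)%R.
      by rewrite -lee_fin -centered_integralE.
    (* Starting at [x - na], the [n] blocks of length [2a] end exactly at [x + na]. *)
    have := @segment_integral_ge_mulrn _ _ q_loc q_ge0 a c a0 ca n (x - a *+ n).
    by rewrite -mulrnA mulnC mulrnA mulr2n addrA subrK.
  apply: (@le_trans _ _ r%:E); last by rewrite lee_fin.
  by apply: ereal_inf_lbound; exists r.
Qed.
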